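(* Let $\langle\cdot,\cdot\rangle$ be a nondegenerate hermitian form on the finite-dimensional complex vector space $V$ preserved by $\rho(\pi_1(V_{12}^* ))$, and let $N_1,N_2$ be the commuting monodromy logarithms. Then there is a splitting $$V=\bigoplus_{a,b}V_{a,b},\qquad W(N_1)_a=\bigoplus_{a'\le a}V_{a',\bullet},\quad W(N_2)_b=\bigoplus_{b'\le b}V_{\bullet,b'},$$ such that (i) $\langle V_{a,b},V_{c,d}\rangle=0$ unless $(c,d)=(-a,-b)$. Moreover, for any splitting $V=\bigoplus_{a,b} V_{a,b}$ of the pair of weight filtrations $(W(N_1),W(N_2))$ as displayed one has automatically (ii) $N_1(V_{a,b})\subset\bigoplus_{a'\le a-2,\ b'\le b}V_{a',b'}$, and symmetrically $N_2(V_{a,b})\subset\bigoplus_{a'\le a,\ b'\le b-2}V_{a',b'}$.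
   Context: Setting: $X$ is a smooth quasi-projective complex variety, $D=D_1\cup D_2$ a divisor with two smooth irreducible components meeting transversally along the smooth $Z$; $V_{12}$ is a polydisc-bundle tubular neighbourhood of $Z$ and $V_{12}^*=V_{12}-D$, a $(\Delta^*\times\Delta^* )$-bundle over $Z$. The loops $\gamma_1,\gamma_2$ around $D_1,D_2$ are central in $\pi_1(V_{12}^* )$. $\rho$ is a representation of $\pi_1(X-D)$ on $V$ (restricted here to $\pi_1(V_{12}^* )$) with $\rho(\gamma_1),\rho(\gamma_2)$ unipotent, and $N_i=\log\rho(\gamma_i)$; so $N_1,N_2$ are commuting nilpotent endomorphisms. $W(N)$ denotes the monodromy weight filtration of a nilpotent endomorphism $N$, centered at $0$: the unique increasing finite filtration with $N W(N)_a\subset W(N)_{a-2}$ and $N^k:\mathrm{Gr}^{W(N)}_k\to\mathrm{Gr}^{W(N)}_{-k}$ an isomorphism for all $k\ge0$. Notation: $V_{a',\bullet}=\bigoplus_bV_{a',b}$ and $V_{\bullet,b'}=\bigoplus_aV_{a,b'}$. *)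

(* Defs.v *)
From HB Require Import structures.
From mathcomp Require Import all_boot all_order all_algebra.
From mathcomp Require Import all_classical.
From mathcomp Require Import reals complex.

Set Implicit Arguments.
Unset Strict Implicit.
Unset Printing Implicit Defensive.

Import Order.TTheory GRing.Theory Num.Theory.

Local Open Scope ring_scope.

Section Endomorphisms.
Variables (K : fieldType) (V : vectType K).
Implicit Types (f N u : 'End(V)).

(* ['End(V)] carries no canonical ring structure (V may be 0), so powers are
   iterated compositions. *)
Definition lfun_pow f (k : nat) : 'End(V) := iter k (comp_lfun f) \1%VF.

Definition unipotent u : Prop := exists n : nat, lfun_pow (u - \1%VF) n = 0.

(* log u = \sum_(k >= 1) (-1)^(k+1) / k * (u - 1)^k.  For unipotent u one has
   (u - 1)^k = 0 as soon as k >= \dim V, so this truncation is the full series. *)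
Definition lfun_log u : 'End(V) :=
  \sum_(1 <= k < (\dim {: V}).+1)
    ((-1) ^+ k.+1 / k%:R) *: lfun_pow (u - \1%VF) k.

(* The last two fields say that the map Gr_k -> Gr_(-k) induced by N^k, where
   Gr_a = W a / W (a - 1), is injective, respectively surjective; it is
   well defined by [wf_shift]. *)
Record is_weight_filtration N (W : int -> {vspace V}) : Prop := {
  wf_incr : forall a b : int, a <= b -> (W a <= W b)%VS;
  wf_finite : exists m n : int, W m = 0%VS /\ W n = fullv;
  wf_shift : forall a : int, (N @: W a <= W (a - 2))%VS;
  wf_inj : forall (k : nat) (x : V), x \in W k%:Z ->
    lfun_pow N k x \in W (- k%:Z - 1) -> x \in W (k%:Z - 1);
  wf_surj : forall (k : nat) (y : V), y \in W (- k%:Z) ->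
    exists2 x, x \in W k%:Z & y - lfun_pow N k x \in W (- k%:Z - 1)
}.

(* W(N): for nilpotent N, the unique filtration satisfying the predicate above
   (constantly 0 if there is none, which never happens for nilpotent N). *)
Definition weight_filtration N : int -> {vspace V} :=
  xget (fun=> 0%VS) [set W | is_weight_filtration N W]%classic.

(* Membership in the sum of the subspaces U i, for i in the possibly infinite
   index set P. *)
Definition in_sum (I : eqType) (P : pred I) (U : I -> {vspace V}) (v : V) : Prop :=
  exists2 s : seq I, all P s & v \in (\sum_(i <- s) U i)%VS.

Definition independent (I : eqType) (U : I -> {vspace V}) : Prop :=
  forall s : seq I, uniq s -> directv (\sum_(i <- s) U i).

(* V = \bigoplus_(a, b) U (a, b), with W1 and W2 recovered from the first,
   respectively second, grading. *)
Record is_splitting (W1 W2 : int -> {vspace V})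
    (U : int * int -> {vspace V}) : Prop := {
  split_direct : independent U;
  split_full : forall v : V, in_sum predT U v;
  split_W1 : forall (a : int) (v : V),
    v \in W1 a <-> in_sum (fun i : int * int => i.1 <= a) U v;
  split_W2 : forall (b : int) (v : V),
    v \in W2 b <-> in_sum (fun i : int * int => i.2 <= b) U v
}.

End Endomorphisms.

(* As in [Algebra.groupType], G need not be finite. *)
Record is_representation (K : fieldType) (V : vectType K) (G : groupType)
    (rho : G -> 'End(V)) : Prop := {
  repr1 : rho 1%g = \1%VF;
  reprM : forall g h : G, rho (g * h)%g = (rho g \o rho h)%VF
}.

Definition central (G : groupType) (g : G) : Prop := forall h : G, commute g h.

(* Main.v *)
Require Import Defs.
From HB Require Import structures.
From mathcomp Require Import all_boot all_order all_algebra.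
From mathcomp Require Import all_classical.
From mathcomp Require Import reals complex.
From mathcomp Require Import zify.

Set Implicit Arguments.
Unset Strict Implicit.
Unset Printing Implicit Defensive.

Import Order.TTheory GRing.Theory Num.Theory.

Local Open Scope ring_scope.

(* Let T_i be the image of gamma_i.  The weight filtration of N_i = log T_i is
   also that of T_i - 1, whose adjoint T_i^-1 - 1 again lowers weights by 2;
   descending along the filtration, this gives W(N_i)_a^\perp = W(N_i)_(-a-1).
   A nondegenerate hermitian form with two self-dual filtrations splits
   orthogonally into anisotropic lines of bidegree (0, 0) and hyperbolic planes
   of bidegrees (a, b) and (-a, -b): pick a least with W1_a <> 0, then b least
   with W1_a :&: W2_b <> 0; by duality a vector e there pairs nontrivially with
   some f in W1_(-a) :&: W2_(-b), and the projection to the line or plane so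
   obtained respects both filtrations.  For (ii), N_1 lowers W1 by 2 and preserves
   W2 by functoriality of weight filtrations. *)

(** Filtrations are known in weights of large absolute value, where they are 0 or everything;
    statements about them then propagate down to weight 0. *)
Lemma descending_nat_ind (P : nat -> Prop) (B : nat) :
  (forall k, (B <= k)%N -> P k) -> (forall k, P k.+1 -> P k) -> forall k, P k.
Proof.
move=> PB PS k.
have PD d : P (k + d)%N -> P k.
  by elim: d => [|d IHd]; rewrite ?addn0 // addnS => /PS.
by apply: (PD B); apply: PB; rewrite leq_addl.
Qed.

(** * Weight filtrations: functoriality, existence, and comparison of [u - 1] with [log u] *)

Section WeightFiltrations.
Variables (K : fieldType) (V : vectType K).
Implicit Types (N M f u : 'End(V)) (W : int -> {vspace V}).

Lemma lfunB f x y : f (x - y) = f x - f y.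
Proof. exact: linearB. Qed.

Lemma lfun_powE f k x : lfun_pow f k x = iter k f x.
Proof. by elim: k => [|k IHk] /=; rewrite ?id_lfunE // comp_lfunE IHk. Qed.

Lemma lfun_powD f j k x :
  lfun_pow f (j + k) x = lfun_pow f j (lfun_pow f k x).
Proof. by rewrite !lfun_powE iterD. Qed.

Lemma lfun_powSr f k x : lfun_pow f k.+1 x = lfun_pow f k (f x).
Proof. by rewrite !lfun_powE iterSr. Qed.

Lemma lfun_pow_commute f (g : 'End(V)) k x :
  (forall y, f (g y) = g (f y)) -> f (lfun_pow g k x) = lfun_pow g k (f x).
Proof. by move=> fg; rewrite !lfun_powE; elim: k => //= k IHk; rewrite fg IHk. Qed.

Lemma wf_sub N W a b x :
  is_weight_filtration N W -> a <= b -> x \in W a -> x \in W b.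
Proof. by move=> WN /(wf_incr WN)/subvP; apply. Qed.

Definition shifts N W := forall a x, x \in W a -> N x \in W (a - 2).

Lemma wf_shifts N W : is_weight_filtration N W -> shifts N W.
Proof. by move=> WN a x /(memv_img N); apply/subvP/wf_shift. Qed.

Lemma shifts_pow N W a k x :
  shifts N W -> x \in W a -> lfun_pow N k x \in W (a - (k%:Z *+ 2)).
Proof.
move=> NW Wx; elim: k => [|k /NW]; first by rewrite lfun_powE /= mul0rn subr0.
by rewrite [lfun_pow N k.+1]/= comp_lfunE; congr (_ \in W _); lia.
Qed.

Lemma shifts_pow_opp N W k x :
  shifts N W -> x \in W k%:Z -> lfun_pow N k x \in W (- k%:Z).
Proof. by move=> NW /(shifts_pow k NW); congr (_ \in W _); lia. Qed.

Lemma shifts_pow_opp1 N W k x :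
  shifts N W -> x \in W (k%:Z - 1) -> lfun_pow N k x \in W (- k%:Z - 1).
Proof. by move=> NW /(shifts_pow k NW); congr (_ \in W _); lia. Qed.

Lemma wf_bound N W : is_weight_filtration N W ->
  exists B : nat, forall k : int, B%:Z <= k -> W k = fullv /\ W (- k - 1) = 0%VS.
Proof.
move=> WN; have [m [n [Wm Wn]]] := wf_finite WN.
exists (`|m| + `|n|)%N => k Bk; split; apply/eqP.
- by rewrite eqEsubv subvf -Wn (wf_incr WN) //; lia.
- by rewrite -subv0 -Wm (wf_incr WN) //; lia.
Qed.

(* Gr_k -> Gr_(-k) being bijective, W_(k-1) and W_(-k) are determined by W_k and
   W_(-k-1); descend from the bounds of the filtration. *)
Lemma wf_morph N W N' W' f : is_weight_filtration N W ->
  is_weight_filtration N' W' -> (forall x, f (N x) = N' (f x)) ->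
  forall a x, x \in W a -> f x \in W' a.
Proof.
move=> WN WN' fN.
have fNk k x : f (lfun_pow N k x) = lfun_pow N' k (f x).
  by rewrite !lfun_powE; elim: k => //= k <-.
suff H k : (forall x, x \in W k%:Z -> f x \in W' k%:Z) /\
           (forall x, x \in W (- k%:Z - 1) -> f x \in W' (- k%:Z - 1)).
  case=> k x; first by have [+ _] := H k; apply.
  by have [_] := H k; rewrite NegzE (_ : - k.+1%:Z = - k%:Z - 1); [apply|lia].
have [B WB] := wf_bound WN; have [B' WB'] := wf_bound WN'.
move: k; apply: (@descending_nat_ind _ (B + B')) => [k Bk|k [IHp IHn]].
  have [|_ W0] := WB k%:Z; first lia.
  have [|W'1 _] := WB' k%:Z; first lia.
  by split=> x; [rewrite W'1 memvf|rewrite W0 memv0 => /eqP->; rewrite linear0 mem0v].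
have eqk : k.+1%:Z - 1 = k%:Z by lia.
have eqk' : - k.+1%:Z = - k%:Z - 1 by lia.
split=> [x Wx|y].
  rewrite -eqk; apply: (wf_inj WN'); first by apply: IHp; apply: (wf_sub WN _ Wx); lia.
  by rewrite -fNk; apply: IHn; apply: shifts_pow_opp1; [exact: wf_shifts|rewrite eqk].
rewrite -eqk' => /(wf_surj WN)[x Wx] /IHn.
rewrite lfunB fNk => Wy.
rewrite -(subrK (lfun_pow N' k.+1 (f x)) (f y)); apply: memvD.
  by apply: (wf_sub WN' _ Wy); lia.
by apply: shifts_pow_opp; [exact: wf_shifts|apply: IHp].
Qed.

Lemma wf_unique N W W' :
  is_weight_filtration N W -> is_weight_filtration N W' -> W = W'.
Proof.
move=> WN WN'; apply/funext => a; apply/vspaceP => x; apply/idP/idP.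
- by move/(@wf_morph _ _ _ _ \1 WN WN'); rewrite id_lfunE; apply=> y; rewrite !id_lfunE.
- by move/(@wf_morph _ _ _ _ \1 WN' WN); rewrite id_lfunE; apply=> y; rewrite !id_lfunE.
Qed.

(* If [lfun_pow N n = 0] this is the sum over all i of im N^i :&: ker N^(a+i+1). *)
Definition explicit_wf N (n : nat) (a : int) : {vspace V} :=
  (\sum_(p : 'I_n.+1 * 'I_n.+1 | (p.2%:Z <= a + p.1%:Z + 1)%R)
     (limg (lfun_pow N p.1) :&: lker (lfun_pow N p.2)))%VS.

(** Exponents of any size are allowed: [N^i x] vanishes for [i >= n], and [j] can be cut down to
    [minn j n] because [N^n = 0]. *)
Lemma mem_explicit_wf N n (i j : nat) (a : int) x : lfun_pow N n = 0 ->
  lfun_pow N j (lfun_pow N i x) = 0 -> j%:Z <= a + i%:Z + 1 ->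
  lfun_pow N i x \in explicit_wf N n a.
Proof.
move=> Nn Nj ja.
have N0 k y : (n <= k)%N -> lfun_pow N k y = 0.
  by move=> nk; rewrite -(subnK nk) lfun_powD Nn zero_lfunE linear0.
have [ni|lt_in] := leqP n i; first by rewrite N0 // mem0v.
have jn : (minn j n < n.+1)%N by lia.
pose p := (Ordinal (leqW lt_in), Ordinal jn).
have : lfun_pow N i x \in (limg (lfun_pow N p.1) :&: lker (lfun_pow N p.2))%VS.
  rewrite memv_cap memv_img ?memvf // memv_ker /= /minn.
  by case: ifP => _; [rewrite Nj|rewrite N0].
by apply/subvP/(sumv_sup p); rewrite ?subvv //=; lia.
Qed.

Lemma explicit_wf_sub N n a (U : {vspace V}) :
  (forall i j x, lfun_pow N j (lfun_pow N i x) = 0 -> j%:Z <= a + i%:Z + 1 ->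
     lfun_pow N i x \in U) ->
  (explicit_wf N n a <= U)%VS.
Proof.
move=> H; apply/subv_sumP => -[i j] /= ja; apply/subvP => y.
rewrite memv_cap memv_ker => /andP[/memv_imgP[x _ ->] /eqP].
by move/H; apply.
Qed.

(** A generator [N^i x] with [i >= k] is [N^k] of [N^(i-k) x], which [N^(j+k)] kills; if [i < k],
    the inequality forces [j = 0] and the generator is 0. The cases [a = k - 1] and [a = k] give
    [wf_inj] and [wf_surj]. *)
Lemma explicit_wf_img N n a k : lfun_pow N n = 0 -> a <= k%:Z ->
  (explicit_wf N n (a - k%:Z *+ 2) <= lfun_pow N k @: explicit_wf N n a)%VS.
Proof.
move=> Nn ak; apply: explicit_wf_sub => i j x Nx ja.
have [ki|lt_ik] := leqP k i; last first.
  have j0 : j = 0 by lia.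
  by move: Nx; rewrite j0 /= id_lfunE => ->; rewrite mem0v.
rewrite -(subnKC ki) lfun_powD memv_img //.
apply: (mem_explicit_wf (j := (j + k)%N)) => //; last lia.
by rewrite -lfun_powD -addnA subnKC // lfun_powD.
Qed.

Lemma explicit_wfP N n :
  lfun_pow N n = 0 -> is_weight_filtration N (explicit_wf N n).
Proof.
move=> Nn; split.
- move=> a b ab; apply: explicit_wf_sub => i j x Nx ja.
  by apply: mem_explicit_wf Nx _ => //; lia.
(* In weight [-n-1] the inequality reads [j <= i - n], which forces [i >= n] and so [N^i = 0]; in
   weight [n], every [x] is [N^0 x], killed by [N^n]. *)
- exists (- n%:Z - 1), n%:Z; split; apply/eqP.
    rewrite -subv0; apply: explicit_wf_sub => i j x Nx ja.
    rewrite memv0; apply/eqP; have [ni|lt_in] := leqP n i.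
      by rewrite -(subnK ni) lfun_powD Nn zero_lfunE linear0.
    lia.
  rewrite eqEsubv subvf; apply/subvP => x _.
  rewrite -[x](id_lfunE x); apply: (mem_explicit_wf (i := 0) (j := n)) => //; last lia.
  by rewrite Nn zero_lfunE.
- move=> a; apply/subvP => _ /memv_imgP[w Ww ->]; rewrite memv_preim.
  apply/subvP: w Ww; apply: explicit_wf_sub => i j x Nx ja; rewrite -memv_preim.
  case: j Nx ja => [|j] Nx ja.
    by move: Nx; rewrite /= id_lfunE => ->; rewrite linear0 mem0v.
  rewrite (_ : N _ = lfun_pow N i.+1 x); last by rewrite /= comp_lfunE.
  apply: (mem_explicit_wf (i := i.+1) (j := j)) => //; last lia.
  by rewrite [lfun_pow N i.+1 x]comp_lfunE -lfun_powSr.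
- move=> k x _; rewrite (_ : - k%:Z - 1 = k%:Z - 1 - k%:Z *+ 2); last lia.
  move/(subvP (explicit_wf_img Nn _)) => /(_ ltac:(lia))/memv_imgP[w Ww Nxw].
  (* [x - w] is killed by [N^k], so the exponents [i = 0], [j = k] place it in weight [k - 1]. *)
  rewrite -(subrK w x) memvD // -[x - w](id_lfunE (x - w)).
  apply: (mem_explicit_wf (i := 0) (j := k)) => //; last lia.
  by rewrite /= id_lfunE lfunB Nxw subrr.
- move=> k y; rewrite (_ : - k%:Z = k%:Z - k%:Z *+ 2); last lia.
  move/(subvP (explicit_wf_img Nn _)) => /(_ ltac:(lia))/memv_imgP[w Ww ->].
  by exists w; rewrite // subrr mem0v.
Qed.

Lemma weight_filtration_eq N W :
  is_weight_filtration N W -> weight_filtration N = W.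
Proof.
move=> WN; apply: (@wf_unique N) => //.
exact: (xgetPex (fun=> 0%VS) (ex_intro [set W | is_weight_filtration N W]%classic W WN)).
Qed.

(* On the graded pieces N^k only depends on N modulo maps of degree -3. *)
Lemma wf_perturb N M W : is_weight_filtration M W ->
  (forall a x, x \in W a -> N x - M x \in W (a - 3)) ->
  is_weight_filtration N W.
Proof.
move=> WM NM; have MW := wf_shifts WM.
have NW : shifts N W.
  move=> a x Wx; rewrite -(subrK (M x) (N x)) memvD ?MW //.
  by apply: (wf_sub WM) (NM _ _ Wx) => //; lia.
have NMk a k x : x \in W a ->
    lfun_pow N k x - lfun_pow M k x \in W (a - k%:Z *+ 2 - 1).
  move=> Wx; elim: k => [|k IHk]; first by rewrite /= subrr mem0v.
  (* Telescoping: [N^(k+1) - M^(k+1) = N (N^k - M^k) + (N - M) M^k]. *)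
  rewrite /= !comp_lfunE -(subrK (N (lfun_pow M k x)) (N _)) -lfunB -addrA.
  apply: memvD; first by apply: (wf_sub WM) (NW _ _ IHk) => //; lia.
  by apply: (wf_sub WM) (NM _ _ (shifts_pow k MW Wx)) => //; lia.
have NMk' k x : x \in W k%:Z ->
    lfun_pow N k x - lfun_pow M k x \in W (- k%:Z - 1).
  by move=> /(NMk _ k); congr (_ \in W _); lia.
split.
- exact: wf_incr WM.
- exact: wf_finite WM.
- by move=> a; apply/subvP => _ /memv_imgP[x Wx ->]; apply: NW.
- move=> k x Wx Nx; apply: (wf_inj WM) => //.
  by rewrite -(subKr (lfun_pow N k x) (lfun_pow M k x)) memvB // NMk'.
- move=> k y /(wf_surj WM)[x Wx yMx]; exists x => //.
  rewrite -(subrK (lfun_pow M k x) y) -addrA memvD //.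
  by rewrite -opprB memvN NMk'.
Qed.

Lemma lfun_log_commute f u x :
  (forall y, f (u y) = u (f y)) -> f (lfun_log u x) = lfun_log u (f x).
Proof.
move=> fu; rewrite /lfun_log !sum_lfunE linear_sum; apply: eq_bigr => k _.
rewrite !scale_lfunE linearZ /= lfun_pow_commute // => y.
by rewrite !add_lfunE !opp_lfunE !id_lfunE lfunB fu.
Qed.

(** [log u - (u - 1)] is a combination of powers of [u - 1] with exponent at least 2, so it lowers
    weights by at least 4. *)
Lemma wf_log u W : is_weight_filtration (u - \1%VF) W ->
  is_weight_filtration (lfun_log u) W.
Proof.
move=> WM; apply: (wf_perturb WM) => a x Wx; rewrite /lfun_log.
(* When [V] is 0 the sum defining [lfun_log] is empty, and there is no leading term to split off. *)
have [d0|d_gt0] := posnP (\dim {: V}).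
  have V0 (y : V) : y = 0.
    by apply/eqP; move: (memvf y); rewrite (eqP (_ : fullv == 0%VS)) ?memv0 // -dimv_eq0 d0.
  by rewrite [_ - _]V0 mem0v.
have -> : (u - \1%VF) x = lfun_pow (u - \1%VF) 1 x by rewrite lfun_powE.
rewrite big_ltn // sqrrN expr1n divr1 scale1r [X in X - _]add_lfunE.
rewrite addrC addKr sum_lfunE big_nat memv_suml // => k /andP[k_gt1 _].
rewrite scale_lfunE memvZ // (wf_sub WM _ (shifts_pow k (wf_shifts WM) Wx)) //.
lia.
Qed.

(** Duality goes through [u - 1], whose adjoint is explicit, and (ii) through [log u]; the same
    filtration serves both. *)
Lemma wf_weight_filtration_log u : unipotent u ->
  is_weight_filtration (u - \1%VF) (weight_filtration (lfun_log u)) /\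
  is_weight_filtration (lfun_log u) (weight_filtration (lfun_log u)).
Proof.
move=> [n /explicit_wfP WM]; have WN := wf_log WM.
by rewrite (weight_filtration_eq WN).
Qed.

End WeightFiltrations.

(** * Orthogonals for a hermitian form and self-duality of weight filtrations *)

Section Duality.
Variables (K : fieldType) (theta : {rmorphism K -> K}) (V : vectType K).
Variable form : {hermitian V for false & theta}.
Implicit Types (E U : {vspace V}) (W : int -> {vspace V}).

Lemma hformC x y : form x y = theta (form y x).
Proof. by rewrite hermC expr0 mul1r. Qed.

Lemma hform_eq0 x y : form x y = 0 -> form y x = 0.
Proof. by move=> xy; rewrite hformC xy rmorph0. Qed.

Lemma hformDl x y z : form (x + y) z = form x z + form y z.
Proof. exact: linearDl. Qed.

Lemma hformDr x y z : form x (y + z) = form x y + form x z.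
Proof. exact: linearDr. Qed.

Lemma hformZl c x y : form (c *: x) y = c * form x y.
Proof. exact: linearZl_LR. Qed.

Lemma hformZr c x y : form x (c *: y) = theta c * form x y.
Proof. exact: linearZr_LR. Qed.

Lemma hformBl x y z : form (x - y) z = form x z - form y z.
Proof. exact: linearBl. Qed.

Lemma hformBr x y z : form x (y - z) = form x y - form x z.
Proof. exact: linearBr. Qed.

(** Each basis vector of [U] imposes one linear condition, costing at most one dimension. *)
Lemma dim_capv_orthov E U : (\dim E <= \dim (E :&: orthov form U) + \dim U)%N.
Proof.
rewrite -[U in orthov _ U](span_basis (vbasisP U)) -{2}(size_tuple (vbasis U)).
elim: (tval _) => [|x X IHX] /=.
  by rewrite span_nil orthov0 capvf addn0.
have -> : orthov form <<x :: X>> = (orthov form <<X>> :&: orthov form <[x]>)%VS.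
  apply/vspaceP => y; rewrite memv_cap.
  apply/mem_orthovP/andP => [H|[/mem_orthovP HX /mem_orthovP Hx] v].
    by split; apply/mem_orthovP => v vX; apply: H; rewrite span_cons;
      [apply: (subvP (addvSr _ _))|apply: (subvP (addvSl _ _))].
  rewrite span_cons => /memv_addP[a /Hx ya [b /HX yb ->]].
  by rewrite hformDr ya yb addr0.
have := leq_dim_orthov1 form x (E :&: orthov form <<X>>); rewrite capvA => le_x.
by apply: (leq_trans IHX); rewrite addnS -addSn leq_add2r (leq_trans (leqSpred _)).
Qed.

Hypothesis form_nondeg : nondegenerate form.

(** The orthogonals of [U] and of its complement meet in the radical, which is 0; so
    [dim_capv_orthov] bounds the dimension of the first by the dimension of the complement. *)
Lemma dim_orthov U : (\dim (orthov form U) + \dim U = \dim {: V})%N.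
Proof.
apply/eqP; rewrite eqn_leq; apply/andP; split; last first.
  by have := dim_capv_orthov fullv U; rewrite capfv.
have := dim_capv_orthov (orthov form U) U^C.
suff -> : (orthov form U :&: orthov form U^C = 0)%VS.
  by rewrite dimv0 dimv_compl; have := dimvS (subvf U); lia.
apply/eqP; rewrite -subv0 -(eqP form_nondeg); apply/subvP => x.
rewrite memv_cap => /andP[/mem_orthovP xU /mem_orthovP xUC].
apply/mem_orthovP => y _; have : y \in (U + U^C)%VS by rewrite addv_complf memvf.
by case/memv_addP=> a /xU xa [b /xUC xb ->]; rewrite hformDr xa xb addr0.
Qed.

Lemma orthovK U : orthov form (orthov form U) = U.
Proof.
apply/esym/eqP; rewrite eqEdim orthov_sym subvv /=.
by have := dim_orthov U; have := dim_orthov (orthov form U); lia.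
Qed.

Variables (M M' : 'End(V)) (W : int -> {vspace V}).
Hypothesis WM : is_weight_filtration M W.
Hypothesis M'W : shifts M' W.
Hypothesis adjM : forall x y, form (M x) y = form x (M' y).

Lemma adjoint_pow k x y : form (lfun_pow M k x) y = form x (lfun_pow M' k y).
Proof.
rewrite !lfun_powE; elim: k x y => //= k IHk x y.
by rewrite adjM IHk -iterS iterSr.
Qed.

Lemma wf_self_dual a : W a = orthov form (W (- a - 1)).
Proof.
(* Taking orthogonals exchanges the claims for [a] and [- a - 1], so nonnegative weights suffice. *)
suff H k : W k%:Z = orthov form (W (- k%:Z - 1)).
  case: a => k //; rewrite NegzE (_ : - - k.+1%:Z - 1 = k%:Z); last lia.
  by rewrite H orthovK; congr W; lia.
have [B WB] := wf_bound WM.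
move: k; apply: (@descending_nat_ind _ B) => [k Bk|k IHk].
  by have [|-> ->] := WB k%:Z; [lia|rewrite orthov0].
have eqk : k%:Z = k.+1%:Z - 1 by lia.
have eqk' : - k%:Z - 1 = - k.+1%:Z by lia.
have orthW x y : x \in W k.+1%:Z -> y \in W (- k.+1%:Z - 1) -> form x y = 0.
  by rewrite IHk => /mem_orthovP; apply.
apply/vspaceP => x; rewrite eqk'; apply/idP/mem_orthovP => [Wx y|xW].
  (* Modulo [W (-k-2)], [y] is some [M^(k+1) z]; across the form this becomes [M'^(k+1) x], which
     lies in [W (-k-2)] and is orthogonal to [z]. *)
  have Wx' : x \in W k.+1%:Z by apply: (wf_sub WM _ Wx); lia.
  move/(wf_surj WM) => [z Wz yMz]; rewrite -(subrK (lfun_pow M k.+1 z) y) hformDr.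
  rewrite orthW // add0r; apply: hform_eq0; rewrite adjoint_pow orthW //.
  by apply: shifts_pow_opp1 => //; rewrite -eqk.
(* Conversely, [M'^(k+1)] sends [W (k+1)] into [W (-k-1)], which is orthogonal to [x]; hence
   [M^(k+1) x] is orthogonal to [W (k+1)], lies in [W (-k-2)], and injectivity on the graded piece
   applies. *)
have Wx : x \in W k.+1%:Z.
  rewrite IHk; apply/mem_orthovP => y Wy; apply: xW; apply: (wf_sub WM _ Wy); lia.
rewrite eqk; apply: (wf_inj WM) => //.
rewrite -[W (_ - 1)]orthovK -IHk; apply/mem_orthovP => y Wy.
by rewrite adjoint_pow xW // shifts_pow_opp.
Qed.

End Duality.

(** * Sums of independent families of subspaces *)

Section SumsOfSubspaces.
Variables (K : fieldType) (V : vectType K) (I : eqType).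
Implicit Types (U : I -> {vspace V}) (P Q : pred I) (s : seq I).

Lemma sumv_seq_sup U s i : i \in s -> (U i <= \sum_(j <- s) U j)%VS.
Proof. by move=> si; rewrite (big_rem i si) addvSl. Qed.

Lemma sumv_seq_sub U s (X : {vspace V}) :
  (forall i, i \in s -> (U i <= X)%VS) -> (\sum_(i <- s) U i <= X)%VS.
Proof.
move=> UX; rewrite big_seq; apply: (big_ind (fun Y => Y <= X)%VS) => //.
  exact: sub0v.
by move=> Y Z YX ZX; rewrite subv_add YX.
Qed.

Lemma sumv_seq_sub_sum U s t :
  {subset s <= t} -> (\sum_(i <- s) U i <= \sum_(i <- t) U i)%VS.
Proof. by move=> st; apply: sumv_seq_sub => i /st; apply: sumv_seq_sup. Qed.

Lemma independent_disjoint U s t : independent U -> uniq (s ++ t) ->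
  (\sum_(i <- s) U i :&: \sum_(i <- t) U i = 0)%VS.
Proof.
move=> indU /indU; rewrite directvE /= !big_cat /= => /eqP dimst.
apply/eqP; rewrite -dimv_eq0.
have := dimv_sum_cap (\sum_(i <- s) U i) (\sum_(i <- t) U i).
have := dimv_leq_sum s xpredT U; have := dimv_leq_sum t xpredT U.
rewrite dimst; lia.
Qed.

(** Split a decomposition of [v] over [P] by [Q]. The part [y] outside [Q] is a difference of two
    vectors supported in [Q], so independence kills it. *)
Lemma in_sum_cap U P Q v : independent U ->
  in_sum P U v -> in_sum Q U v -> in_sum (predI P Q) U v.
Proof.
move=> indU [s /allP sP vs] [t /allP tQ vt].
(* [independent] speaks of duplicate-free lists, hence the [undup]. *)
pose sQ := [seq i <- s | Q i]; pose sQ' := undup [seq i <- s | ~~ Q i].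
exists sQ; first by apply/allP => i; rewrite mem_filter /= => /andP[-> /sP->].
have : v \in (\sum_(i <- sQ) U i + \sum_(i <- sQ') U i)%VS.
  move: vs; apply/subvP/sumv_seq_sub => i si.
  have [Qi|Q'i] := boolP (Q i).
    by apply: (subv_trans _ (addvSl _ _)); rewrite sumv_seq_sup // mem_filter Qi.
  by apply: (subv_trans _ (addvSr _ _));
    rewrite sumv_seq_sup // mem_undup mem_filter Q'i.
case/memv_addP => x xQ [y yQ' vE].
suff y0 : y = 0 by rewrite vE y0 addr0.
apply/eqP; rewrite -memv0 -(@independent_disjoint U sQ' (undup (sQ ++ t))) //.
  rewrite memv_cap yQ' -(addKr x y) -vE addrC memvB //.
    by apply: subvP vt; apply: sumv_seq_sub_sum => i it; rewrite mem_undup mem_cat it orbT.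
  by apply: subvP xQ; apply: sumv_seq_sub_sum => i iQ; rewrite mem_undup mem_cat iQ.
rewrite cat_uniq !undup_uniq andbT /=; apply/hasPn => i.
rewrite !mem_undup mem_cat !mem_filter negb_and negbK => iQ.
by apply/orP; left; case/orP: iQ => [/andP[]|/tQ].
Qed.

End SumsOfSubspaces.

(** * Gradings given by lists of vectors labelled with degrees *)

Section GradedFamilies.
Variables (K : fieldType) (V : vectType K) (I : eqType).
Implicit Types (s t : seq (V * I)) (P Q : pred I).

(** A labelled list carries a basis and its grading together: [pred1 i] cuts out a graded piece, a
    bound on the labels a step of a filtration. *)
Definition tspan s P : {vspace V} := <<[seq u.1 | u <- s & P u.2]>>%VS.

Lemma mem_tspan s P u : u \in s -> P u.2 -> u.1 \in tspan s P.
Proof. by move=> su Pu; rewrite memv_span // map_f // mem_filter Pu. Qed.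

Lemma tspan_subP s P (X : {vspace V}) :
  (forall u, u \in s -> P u.2 -> u.1 \in X) -> (tspan s P <= X)%VS.
Proof.
move=> H; apply/span_subvP => _ /mapP[u + ->].
by rewrite mem_filter => /andP[Pu /H]; apply.
Qed.

Lemma tspan_cat s t P : tspan (s ++ t) P = (tspan s P + tspan t P)%VS.
Proof. by rewrite /tspan filter_cat map_cat span_cat. Qed.

Lemma tspanT s : tspan s predT = <<unzip1 s>>%VS.
Proof. by rewrite /tspan filter_predT. Qed.

Lemma in_sum_tspan s P v :
  in_sum P (fun i => tspan s (pred1 i)) v <-> v \in tspan s P.
Proof.
split=> [[r /allP rP]|].
  apply/subvP/sumv_seq_sub => i /rP Pi; apply: tspan_subP => u su /= /eqP ui.
  by rewrite mem_tspan // ui.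
(* Only the labels occurring in [s] contribute, so they provide the finite index list. *)
move=> vs; exists [seq u.2 | u <- s & P u.2].
  by apply/allP => _ /mapP[u + ->]; rewrite mem_filter => /andP[].
move: vs; apply/subvP/tspan_subP => u su Pu.
apply: (subvP (sumv_seq_sup (i := u.2) _ _)).
  by rewrite map_f // mem_filter Pu.
by rewrite mem_tspan //=.
Qed.

Lemma dim_tspan s P : free (unzip1 s) -> \dim (tspan s P) = count (P \o snd) s.
Proof.
move=> fs; have : free [seq u.1 | u <- s & P u.2].
  elim: s fs => //= u s IHs; rewrite free_cons => /andP[us /IHs fs].
  case: ifP => //= _; rewrite free_cons fs andbT; apply: contra us.
  rewrite -tspanT; apply/subvP; rewrite -/(tspan s P).
  by apply: tspan_subP => w sw _; rewrite mem_tspan.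
by move/eqP; rewrite /tspan => ->; rewrite size_map size_filter.
Qed.

(** For a free list the dimension of each span is a count of labels, and counts add up over distinct
    labels. *)
Lemma independent_tspan s : free (unzip1 s) ->
  independent (fun i => tspan s (pred1 i)).
Proof.
move=> fs r ur; rewrite directvE /=; apply/eqP.
have -> : (\sum_(i <- r) tspan s (pred1 i) = tspan s (mem r))%VS.
  apply/vspaceP => v; apply/idP/idP => [vr|].
    by apply/in_sum_tspan; exists r => //; apply/allP.
  apply/subvP/tspan_subP => u su ur2.
  by apply: (subvP (sumv_seq_sup _ ur2)); rewrite mem_tspan //=.
rewrite dim_tspan // (eq_bigr _ (fun i _ => dim_tspan (pred1 i) fs)).
elim: r ur => [_|i r IHr /= /andP[ir /IHr IH]].
  by rewrite big_nil; apply/eqP; rewrite -leqn0 leqNgt -has_count; apply/hasP => -[].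
rewrite big_cons -IH -count_predUI -[LHS]addn0; congr (_ + _)%N.
apply/eqP; rewrite eq_sym -leqn0 leqNgt -has_count.
by apply/hasP => -[u _ /= /andP[/eqP-> ]]; apply/negP.
Qed.

End GradedFamilies.

(** * Orthogonal splitting of a pair of self-dual filtrations *)

Section AdaptedBases.
Variables (K : fieldType) (theta : {rmorphism K -> K}) (V : vectType K).
Variable form : {hermitian V for false & theta}.
Hypothesis two_neq0 : 2%:R != 0 :> K.

(* The two filtrations are handled together: [false] stands for the first one,
   [true] for the second one. *)
Variable W : bool -> int -> {vspace V}.
Definition deg (j : bool) (i : int * int) : int := if j then i.2 else i.1.

Definition upto (j : bool) (a : int) : pred (int * int) := fun i => deg j i <= a.

Hypothesis W_incr : forall j (a b : int), a <= b -> (W j a <= W j b)%VS.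
Hypothesis W_finite : forall j, exists m n, W j m = 0%VS /\ W j n = fullv.
Hypothesis W_dual : forall j a, W j a = orthov form (W j (- a - 1)).

Implicit Types (E : {vspace V}) (s t : seq (V * (int * int))).

Lemma deg_opp j (i : int * int) : deg j (- i.1, - i.2) = - deg j i.
Proof. by case: j. Qed.

Lemma W_orth j a b x y : x \in W j a -> y \in W j b -> form x y != 0 -> 0 <= a + b.
Proof.
move=> Wx Wy; apply: contraNT => ab; apply/eqP; move: Wx.
rewrite W_dual => /mem_orthovP; apply; move: Wy; apply/subvP/W_incr; lia.
Qed.

(** The half of self-duality on [E] that is not inherited from [W_dual]; it is the invariant kept
    while pieces are split off. *)
Definition self_dual_on E := forall j a x, x \in E ->
  (forall y, y \in E -> y \in W j (- a - 1) -> form x y = 0) -> x \in W j a.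

Record homogeneous E s : Prop := {
  hom_free : free (unzip1 s);
  hom_mem : forall u, u \in s -> u.1 \in E /\ forall j, u.1 \in W j (deg j u.2);
  hom_orth : forall u v, u \in s -> v \in s ->
    v.2 <> (- u.2.1, - u.2.2) -> form u.1 v.1 = 0
}.

Definition adapted E s :=
  homogeneous E s /\ forall j a x, x \in E -> x \in W j a ->
    x \in tspan s (upto j a).

Definition projects s x y := forall j a, x \in W j a ->
  y \in tspan s (upto j a).

(* In [so_proj], [y] is the orthogonal projection of [x] to the span of [t]. *)
Record splits_off E t : Prop := {
  so_hom : homogeneous E t;
  so_nil : t != [::];
  so_nondeg : forall x, x \in <<unzip1 t>>%VS -> x \in orthov form <<unzip1 t>> -> x = 0;
  so_proj : forall x, x \in E -> exists2 y,
    x - y \in orthov form <<unzip1 t>> & projects t x y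
}.

Lemma tspan_sub_unzip t P : (tspan t P <= <<unzip1 t>>)%VS.
Proof. by rewrite -tspanT; apply: tspan_subP => u tu _; rewrite mem_tspan. Qed.

Lemma projects_span t x y : projects t x y -> y \in <<unzip1 t>>%VS.
Proof.
have [m [n [_ Wn]]] := W_finite false.
by move/(_ false n); rewrite Wn memvf => /(_ isT); apply/subvP/tspan_sub_unzip.
Qed.

Lemma tspan_sub_W E t j a : homogeneous E t ->
  (tspan t (upto j a) <= E :&: W j a)%VS.
Proof.
move=> ht; apply: tspan_subP => u /(hom_mem ht)[uE uW] ua.
by rewrite memv_cap uE; move: (uW j); apply/subvP/W_incr.
Qed.

Lemma projects_W E t j a x y : homogeneous E t -> projects t x y -> x \in W j a ->
  y \in W j a.
Proof.
by move=> /tspan_sub_W ht xy /xy; apply/subvP/(subv_trans (ht _ _))/capvSr.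
Qed.

Lemma span_homogeneous E t : homogeneous E t -> (<<unzip1 t>> <= E)%VS.
Proof. by move=> ht; apply/span_subvP => _ /mapP[u /(hom_mem ht)[uE _] ->]. Qed.

(** A test vector [y] in [E] may be replaced by [y - z], with [z] its projection: [x] is orthogonal
    to [z], and [y - z] lies in the complement without gaining weight. *)
Lemma splits_off_self_dual E t : splits_off E t -> self_dual_on E ->
  self_dual_on (E :&: orthov form <<unzip1 t>>).
Proof.
move=> [ht _ _ pt] dE j a x; rewrite memv_cap => /andP[xE /mem_orthovP xt] xW.
apply: dE => // y yE yW; have [z yz tz] := pt y yE.
have zt := projects_span tz.
rewrite -(subrK z y) hformDr (xt z) // addr0; apply: xW.
  by rewrite memv_cap yz memvB // (subvP (span_homogeneous ht)).
by rewrite memvB //; exact: (projects_W ht tz yW).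
Qed.

Lemma splits_off_dim E t : splits_off E t ->
  (\dim (E :&: orthov form <<unzip1 t>>) < \dim E)%N.
Proof.
move=> [ht nil_t nd _]; rewrite ltn_neqAle dimvS ?capvSl // andbT.
apply/negP => /eqP dimE.
have /eqP EE : (E :&: orthov form <<unzip1 t>>)%VS == E.
  by rewrite eqEdim capvSl dimE leqnn.
case: t nil_t ht nd EE {dimE} => // u t _ ht nd EE.
have /memv_span ut : u.1 \in unzip1 (u :: t) by rewrite map_f ?mem_head.
have [uE _] := hom_mem ht (mem_head u t).
have := free_not0 (hom_free ht) (map_f _ (mem_head u t)).
rewrite (nd u.1) ?eqxx //.
by move: uE; rewrite -EE memv_cap => /andP[].
Qed.

(** Nondegeneracy on the span of [t] gives freeness. For adaptedness, the projection [y] of [x] and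
    the remainder [x - y] both stay in the filtration steps of [x]. *)
Lemma adapted_cat E t s : splits_off E t ->
  adapted (E :&: orthov form <<unzip1 t>>) s -> adapted E (t ++ s).
Proof.
move=> [ht _ nd pt] [hs spans].
have orth x y : x \in <<unzip1 s>>%VS -> y \in <<unzip1 t>>%VS -> form x y = 0.
  move=> /(subvP (span_homogeneous hs)); rewrite memv_cap => /andP[_].
  by move/mem_orthovP; apply.
have orth1 u v : u \in s -> v \in t -> form u.1 v.1 = 0.
  by move=> us vt; apply: orth; rewrite memv_span ?map_f.
split; first split.
- rewrite /unzip1 map_cat cat_free (hom_free ht) (hom_free hs) /=.
  apply/directv_addP/eqP; rewrite -subv0; apply/subvP => x.
  rewrite memv_cap memv0 => /andP[xt xs]; apply/eqP/nd => //.
  by apply/mem_orthovP => y; apply: orth.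
- move=> u; rewrite mem_cat => /orP[/(hom_mem ht)//|/(hom_mem hs)].
  by rewrite memv_cap => -[/andP[]].
- move=> u v; rewrite !mem_cat => /orP[ut|us] /orP[vt|vs] uv.
  + exact: (hom_orth ht).
  + exact/hform_eq0/orth1.
  + exact: orth1.
  + exact: (hom_orth hs).
- move=> j a x xE xW; rewrite tspan_cat.
  have [y xy ty] := pt x xE; rewrite -(subrK y x) addrC memv_add ?ty //.
  have yW := projects_W ht ty xW.
  apply: spans; last exact: memvB.
  by rewrite memv_cap xy memvB // (subvP (span_homogeneous ht)) // (projects_span ty).
Qed.

Lemma projectsD t x y z : projects t x y -> projects t x z -> projects t x (y + z).
Proof. by move=> xy xz j a xW; rewrite memvD ?xy ?xz. Qed.

(** A nonzero coordinate [form x f] forces the weight of [x] to be at least that of [u], by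
    [W_orth]. *)
Lemma projects_coord t u f x : u \in t -> (forall j, f \in W j (- deg j u.2)) ->
  projects t x (form x f *: u.1).
Proof.
move=> ut fW j a xW; have [->|/(W_orth xW (fW j)) ua] := eqVneq (form x f) 0.
  by rewrite scale0r mem0v.
by rewrite memvZ // mem_tspan // /upto -subr_ge0.
Qed.

Lemma anisotropic_splits_off E e : e \in E -> (forall j, e \in W j 0) ->
  form e e != 0 -> splits_off E [:: (e, (0, 0))].
Proof.
move=> eE eW ee; have deg0 j : deg j (0, 0) = 0 by case: j.
split=> //.
- split=> /=.
  + by rewrite seq1_free; apply: contraNneq ee => ->; rewrite linear0l.
  + by move=> u; rewrite inE => /eqP-> /=; split=> // j; rewrite deg0.
  + by move=> u v; rewrite !inE => /eqP-> /eqP-> /=; rewrite oppr0.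
- move=> x; rewrite /= span_seq1 => /vlineP[c ->]; rewrite mem_orthov1 hformZl.
  by rewrite mulf_eq0 (negPf ee) orbF => /eqP->; rewrite scale0r.
- move=> x xE; exists ((form x e / form e e) *: e).
    by rewrite /= span_seq1 mem_orthov1 hformBl hformZl mulfVK // subrr.
  rewrite mulrC -scalerA => j a xW; rewrite memvZ //.
  apply: (@projects_coord _ (e, (0, 0)) e) => //; first exact: mem_head.
  by move=> k; rewrite deg0 oppr0.
Qed.

(* [f] is isotropic and [form e e] vanishes unless [f] is in the same steps of
   both filtrations as [e], so subtracting a multiple of [f] makes [e] isotropic. *)
Lemma hyperbolic_splits_off E e f i : e \in E -> f \in E ->
  (forall j, e \in W j (deg j i)) -> (forall j, f \in W j (- deg j i)) ->
  form e f = 1 -> form f f = 0 -> exists t, splits_off E t.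
Proof.
move=> eE fE eW fW ef ff.
have fe : form f e = 1 by rewrite hformC ef rmorph1.
(* [form e e] is fixed by [theta], hence so is [c], and [form g g = form e e - c - theta c = 0]. *)
pose c := form e e / 2%:R.
have thc : theta c = c by rewrite /c rmorphM fmorphV rmorph_nat -hformC.
pose g := e - c *: f.
have gf : form g f = 1 by rewrite hformBl hformZl ef ff mulr0 subr0.
have fg : form f g = 1 by rewrite hformC gf rmorph1.
have gg : form g g = 0.
  rewrite hformBr hformZr thc gf /g hformBl hformZl fe !mulr1 -addrA -opprD.
  by rewrite -mulr2n -mulr_natr /c mulfVK // subrr.
have gE : g \in E by rewrite memvB ?memvZ.
have gW j : g \in W j (deg j i).
  rewrite memvB //; have [ee|/(W_orth (eW j) (eW j)) i_ge0] := eqVneq (form e e) 0.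
    by rewrite /c ee mul0r scale0r mem0v.
  by rewrite memvZ //; move: (fW j); apply/subvP/W_incr; lia.
pose t := [:: (g, i); (f, (- i.1, - i.2))].
have span_t : <<unzip1 t>>%VS = (<[g]> + <[f]>)%VS.
  by rewrite /= span_cons span_seq1.
have orthE x : (x \in orthov form <<unzip1 t>>) = (form x g == 0) && (form x f == 0).
  rewrite span_t; apply/mem_orthovP/andP => [xt|[/eqP xg /eqP xf] y].
    by split; rewrite xt // memvE ?addvSl ?addvSr.
  by case/memv_addP=> _ /vlineP[a ->] [_ /vlineP[b ->] ->];
    rewrite hformDr !hformZr xg xf !mulr0 addr0.
exists t; split=> //.
- split=> /=.
  + rewrite free_cons seq1_free span_seq1; apply/andP; split; last first.
      by apply/eqP => f0; move/eqP: fg; rewrite f0 linear0l eq_sym oner_eq0.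
    apply/vlineP => -[a ga]; move/eqP: gf; rewrite {1}ga hformZl ff mulr0.
    by rewrite eq_sym oner_eq0.
  + by move=> u; rewrite !inE => /orP[] /eqP->; split=> // j; rewrite /= ?deg_opp.
  + move=> u v; rewrite !inE => /orP[] /eqP-> /orP[] /eqP-> //=.
    by rewrite !opprK -surjective_pairing.
- move=> x; rewrite orthE span_t.
  case/memv_addP=> _ /vlineP[a ->] [_ /vlineP[b ->] ->].
  rewrite !hformDl !hformZl gg gf fg ff !mulr0 !mulr1 add0r addr0.
  by case/andP=> /eqP-> /eqP->; rewrite !scale0r addr0.
(* In the hyperbolic plane [g] and [f] are dual to each other, so the coordinate along each is the
   pairing with the other. *)
- move=> x xE; exists (form x f *: g + form x g *: f).
    rewrite orthE !hformBl !hformDl !hformZl gg gf fg ff.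
    by rewrite !mulr0 !mulr1 add0r addr0 !subrr eqxx.
  apply: projectsD.
    exact: (@projects_coord t (g, i) f x (mem_head _ _) fW).
  apply: (@projects_coord t (f, (- i.1, - i.2)) g x).
    by rewrite !inE eqxx orbT.
  by move=> j; rewrite deg_opp opprK.
Qed.

Lemma least_int (P : pred int) m n : ~~ P m -> P n ->
  (forall a b : int, a <= b -> P a -> P b) -> exists a, P a /\ ~~ P (a - 1).
Proof.
move=> Pm Pn Pincr.
have exP : exists k : nat, P (m + k%:Z).
  by exists `|n - m|%N; apply: Pincr Pn; lia.
case: (ex_minnP exP) => -[|k] Pk mink; first by rewrite addr0 (negPf Pm) in Pk.
exists (m + k.+1%:Z); split=> //; apply/negP => Pk'.
by have := mink k; rewrite (_ : m + k%:Z = m + k.+1%:Z - 1) ?ltnn; [move/(_ Pk')|]; lia.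
Qed.

Lemma least_step E j : E != 0%VS ->
  exists a, (E :&: W j a)%VS != 0%VS /\ (E :&: W j (a - 1) = 0)%VS.
Proof.
move=> E0; have [m [n [Wm Wn]]] := W_finite j.
have [|||a [Ea Ea']] := @least_int (fun a => E :&: W j a != 0)%VS m n.
- by rewrite Wm capv0 eqxx.
- by rewrite Wn capvf.
- move=> a b /(W_incr j) Wab; apply: contraNN; rewrite -!subv0.
  exact/subv_trans/capvS.
- by exists a; split=> //; apply/eqP; rewrite negbK in Ea'.
Qed.

Lemma exists_splits_off E : self_dual_on E -> E != 0%VS -> exists t, splits_off E t.
Proof.
have eq0 (d : int) : 0 <= - d + - d -> 0 <= d + d -> d = 0 by lia.
move=> dE E0.
have [a [Ea Ea']] := least_step false E0.
have [b [Eb Eb']] := least_step true Ea.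
pose i := (a, b); pose e := vpick (E :&: W false a :&: W true b)%VS.
have /memv_capP[/memv_capP[eE eWa] eWb] := memv_pick (E :&: W false a :&: W true b)%VS.
rewrite -/e in eE eWa eWb.
have eW j : e \in W j (deg j i) by case: j.
have : ~~ (E :&: W true (- b) <= orthov form <[e]>)%VS.
  (* Otherwise self-duality would put [e] in [W true (b - 1)], against the minimality of [b]. *)
  apply: contraNN Eb => /subvP eb; rewrite -vpick0 -/e -memv0 -Eb'.
  rewrite !memv_cap eE eWa; apply: dE => // y yE yW; apply: hform_eq0; apply/eqP.
  rewrite -mem_orthov1; apply: eb; rewrite memv_cap yE.
  by move: yW; congr (_ \in W _ _); lia.
case/subvPn=> f; rewrite memv_cap mem_orthov1 => /andP[fE fWb] fe.
(* The test vectors here lie in [E :&: W false (a - 1)], which is 0 by minimality of [a]. *)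
have fWa : f \in W false (- a).
  apply: dE => // y yE; rewrite opprK => yW.
  have : y \in (E :&: W false (a - 1))%VS by rewrite memv_cap yE.
  by rewrite Ea' memv0 => /eqP->; rewrite linear0r.
have fW j : f \in W j (- deg j i) by case: j.
pose g := (form e f)^-1 *: e.
have ef : form e f != 0 by apply: contraNneq fe => /hform_eq0->.
have gE : g \in E by rewrite memvZ.
have gW j : g \in W j (deg j i) by rewrite memvZ.
have gf : form g f = 1 by rewrite hformZl mulVf.
have fg : form f g = 1 by rewrite hformC gf rmorph1.
have [ff|ff] := eqVneq (form f f) 0.
  exact: (hyperbolic_splits_off gE fE gW fW gf ff).
(* If [g] is isotropic, [f] and [g] exchange roles, in bidegree [(- a, - b)]. *)
have [gg|gg] := eqVneq (form g g) 0.
  apply: (@hyperbolic_splits_off _ f g (- a, - b)) => // j.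
    by rewrite (deg_opp j i).
  by rewrite (deg_opp j i) opprK.
(* When both are anisotropic, [W_orth] forces [deg j i = 0] for each [j], so [g] spans a line of
   bidegree [(0, 0)]. *)
exists [:: (g, (0, 0))]; apply: anisotropic_splits_off => // j.
have i0 := eq0 _ (W_orth (fW j) (fW j) ff) (W_orth (gW j) (gW j) gg).
by move: (gW j); rewrite i0.
Qed.

Lemma exists_adapted E : self_dual_on E -> exists s, adapted E s.
Proof.
have [n] := ubnP (\dim E); elim: n E => // n IHn E dimE dE.
have [E0|E0] := eqVneq E 0%VS.
  exists [::]; split=> [|j a x]; last by rewrite E0 memv0 => /eqP-> _; rewrite mem0v.
  by split=> //; apply: nil_free.
have [t tE] := exists_splits_off dE E0.
have [||s sE] := IHn (E :&: orthov form <<unzip1 t>>)%VS.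
- exact: leq_trans (splits_off_dim tE) _.
- exact: splits_off_self_dual.
- by exists (t ++ s); apply: adapted_cat.
Qed.

Lemma exists_orthogonal_splitting : exists2 U : int * int -> {vspace V},
  is_splitting (W false) (W true) U &
  forall a b c d : int, (c, d) <> (- a, - b) ->
    forall u v : V, u \in U (a, b) -> v \in U (c, d) -> form u v = 0.
Proof.
have [|s [hs spans]] := @exists_adapted fullv.
  by move=> j a x _ xW; rewrite W_dual; apply/mem_orthovP => y; apply: xW; rewrite memvf.
have spanW j a v : v \in W j a <-> in_sum (upto j a) (fun i => tspan s (pred1 i)) v.
  split=> [vW|/in_sum_tspan]; first by apply/in_sum_tspan/spans; rewrite ?memvf.
  by move/(subvP (tspan_sub_W _ _ hs)); rewrite capfv.
exists (fun i => tspan s (pred1 i)).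
  split.
  - exact/independent_tspan/hom_free/hs.
  - move=> v; have [m [n [_ Wn]]] := W_finite false.
    have /spanW[r _ vr] : v \in W false n by rewrite Wn memvf.
    by exists r => //; apply/allP.
  - exact: (spanW false).
  - exact: (spanW true).
move=> a b c d cd u v us vs.
suff /subvP/(_ u us)/mem_orthovP : (tspan s (pred1 (a, b)) <=
    orthov form (tspan s (pred1 (c, d))))%VS by apply.
apply: tspan_subP => u' su /eqP uab; apply/mem_orthovP => v' v's.
apply/hform_eq0/eqP; rewrite -mem_orthov1; move: v' v's; apply/subvP.
apply: tspan_subP => v' sv /eqP vcd; rewrite mem_orthov1; apply/eqP/hform_eq0.
by apply: (hom_orth hs su sv); rewrite uab vcd.
Qed.

End AdaptedBases.

(** * Self-duality for isometric representations, and the theorem *)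

Section Representations.
Variables (K : fieldType) (V : vectType K) (G : groupType) (rho : G -> 'End(V)).
Hypothesis rho_repr : is_representation rho.

Lemma repr_commute g h x : commute g h -> rho g (rho h x) = rho h (rho g x).
Proof. by move=> gh; rewrite -!comp_lfunE -!(reprM rho_repr) gh. Qed.

Lemma repr_invK g x : rho g^-1%g (rho g x) = x.
Proof. by rewrite -comp_lfunE -(reprM rho_repr) mulVg (repr1 rho_repr) id_lfunE. Qed.

(* g^-1 - 1 = - g^-1 o (g - 1), and g^-1 preserves the weight filtration of
   g - 1 because it commutes with g. *)
Lemma shifts_repr_inv g W : is_weight_filtration (rho g - \1%VF) W ->
  shifts (rho g^-1%g - \1%VF) W.
Proof.
move=> WM a x Wx.
have -> : (rho g^-1%g - \1%VF) x = - rho g^-1%g ((rho g - \1%VF) x).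
  by rewrite !(add_lfunE, opp_lfunE, id_lfunE) lfunB repr_invK opprB.
rewrite memvN; apply: (wf_morph WM WM) (wf_shifts WM Wx) => y.
rewrite !(add_lfunE, opp_lfunE, id_lfunE) lfunB repr_commute //.
by rewrite /commute mulVg mulgV.
Qed.

Lemma self_dual_weight_filtration (theta : {rmorphism K -> K})
    (form : {hermitian V for false & theta}) (g : G) (a : int) :
  nondegenerate form -> (forall h x y, form (rho h x) (rho h y) = form x y) ->
  unipotent (rho g) ->
  weight_filtration (lfun_log (rho g)) a =
  orthov form (weight_filtration (lfun_log (rho g)) (- a - 1)).
Proof.
move=> nd inv /wf_weight_filtration_log[WM _].
apply: (wf_self_dual nd WM (shifts_repr_inv WM)) => x y.
rewrite !(add_lfunE, opp_lfunE, id_lfunE) hformBl hformBr; congr (_ - _).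
(* Invariance under [g^-1] makes [rho g^-1] the adjoint of [rho g]. *)
by rewrite -[LHS](inv g^-1%g) repr_invK.
Qed.

End Representations.

Theorem proposition7p3 (R : realType) (V : vectType R[i]) (G : groupType)
    (rho : G -> 'End(V)) (gamma1 gamma2 : G)
    (form : {hermitian V for false & @conjc R})
    (rho_repr : is_representation rho)
    (gamma1_central : central gamma1) (gamma2_central : central gamma2)
    (gamma1_unip : unipotent (rho gamma1)) (gamma2_unip : unipotent (rho gamma2))
    (form_nondeg : nondegenerate form)
    (form_inv : forall (g : G) (u v : V), form (rho g u) (rho g v) = form u v) :
  let N1 := lfun_log (rho gamma1) in
  let N2 := lfun_log (rho gamma2) in
  let W1 := weight_filtration N1 in
  let W2 := weight_filtration N2 in
  (exists2 U : int * int -> {vspace V}, is_splitting W1 W2 U &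
     forall a b c d : int, (c, d) <> (- a, - b) ->
       forall u v : V, u \in U (a, b) -> v \in U (c, d) -> form u v = 0)
  /\
  (forall U : int * int -> {vspace V}, is_splitting W1 W2 U ->
     forall (a b : int) (v : V), v \in U (a, b) ->
       in_sum (fun i : int * int => (i.1 <= a - 2) && (i.2 <= b)) U (N1 v) /\
       in_sum (fun i : int * int => (i.1 <= a) && (i.2 <= b - 2)) U (N2 v)).
Proof.
move=> N1 N2 W1 W2.
have [_ WN1] := wf_weight_filtration_log gamma1_unip.
have [_ WN2] := wf_weight_filtration_log gamma2_unip.
split.
  apply: (@exists_orthogonal_splitting _ _ _ form _
            (fun j => if j then W2 else W1)).
  - by rewrite pnatr_eq0.
  - by case; [apply: (wf_incr WN2)|apply: (wf_incr WN1)].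
  - by case; [apply: (wf_finite WN2)|apply: (wf_finite WN1)].
  - by case=> a; apply: (self_dual_weight_filtration rho_repr).
have N12 x : N1 (N2 x) = N2 (N1 x).
  (* Commutation passes to the logarithms one factor at a time. *)
  apply: lfun_log_commute => y; apply/esym/lfun_log_commute => z.
  exact/(repr_commute rho_repr)/esym/gamma1_central.
move=> U [indU _ UW1 UW2] a b v vU.
have Uab (P : pred (int * int)) : P (a, b) -> in_sum P U v.
  by move=> Pab; exists [:: (a, b)]; rewrite ?big_seq1 //= Pab.
have vW1 : v \in W1 a by apply/UW1/Uab => /=.
have vW2 : v \in W2 b by apply/UW2/Uab => /=.
(* In each half one bound comes from lowering weights by 2 and the other from functoriality;
   directness merges the two into one sum. *)
split; apply: (in_sum_cap indU).
- exact/UW1/(wf_shifts WN1).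
- exact/UW2/(wf_morph WN2 WN2 N12).
- by apply/UW1/(wf_morph WN1 WN1) => // x; rewrite N12.
- exact/UW2/(wf_shifts WN2).
Qed.
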